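(* Let $\mathcal X\times\mathcal U\subseteq\mathbb R^n\times\mathbb R^m$ be a neighborhood of the origin and let $f:\mathcal X\times\mathcal U\to\mathbb R^n$ be continuous with $f(0,0)=0$. If $f$ satisfies Brockett's condition, i.e. $f$ is open at $(0,0)$, then the control system $\dot x=f(x,u)$ is locally exponentially stabilizable by means of a composition operator with a (not necessarily continuous) stationary symbol.
   Context: $f$ is open at a point $\bar z$ if $f(\bar z)\in\operatorname{int} f(\mathcal V)$ for every neighborhood $\mathcal V$ of $\bar z$. For a neighborhood of the origin $\mathcal O\subseteq\mathcal X$ and a map $h:\mathcal O\to\mathcal X\times\mathcal U$ (no continuity required), the composition operator $T_h$ with symbol $h$ is defined by $T_hf:=f\circ h$. The system $\dot x=f(x,u)$ is locally exponentially stabilizable by means of a composition operator $T_h$ if there are such an $\mathcal O$ and $h$ for which the origin is a locally exponentially stable equilibrium of $\dot x=T_hf(x)$. The symbol is stationary if $h(0)=(0,0)$. Standing assumption (uniqueness criterion): a stabilizing composition operator $T_h$ is always required to be such that $T_hf$ is continuous and $\dot x=T_hf(x)$ has a unique solution $x(t)$ for all $t\ge0$ and all initial states $x_0$ in a neighborhood of the origin. *)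

(* Defs.v *)
From HB Require Import structures.
From mathcomp Require Import all_boot all_order all_algebra.
From mathcomp Require Import all_classical all_reals all_analysis.
Set Implicit Arguments.
Unset Strict Implicit.
Unset Printing Implicit Defensive.
Import Order.TTheory GRing.Theory Num.Theory.
Import numFieldNormedType.Exports.
Local Open Scope classical_set_scope.
Local Open Scope ring_scope.

(* A map defined on a set D is a total function considered only on D; its
   values outside D are never used. The Euclidean spaces R^n are 'rV[R]_n with
   the library (maximum) norm; exponential stability does not depend on the
   choice of norm. *)

(* Neighborhoods of z are taken relative to the domain D of f. *)
Definition open_at (S T : topologicalType) (D : set S) (f : S -> T) (z : S) :
    Prop :=
  forall V : set S, nbhs z V -> interior (f @` (V `&` D)) (f z).

Definition comp_op (A B C : Type) (h : A -> B) (f : B -> C) : A -> C := f \o h.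

(* x solves x' = F(x) in O on the interval [0, T[, where T may be +oo. The
   derivative at t is relative to [0, +oo[, i.e. the right derivative at 0. *)
Definition is_solution (R : realType) (n : nat) (O : set 'rV[R]_n)
    (F : 'rV[R]_n -> 'rV[R]_n) (T : \bar R) (x : R -> 'rV[R]_n) : Prop :=
  forall t : R, 0 <= t -> (t%:E < T)%E ->
    O (x t) /\
    (s - t)^-1 *: (x s - x t) @[s --> within [set s : R | 0 <= s] t^']
      --> F (x t).

(* Uniqueness is required among all solutions starting at x0, including those
   defined on a bounded interval only. *)
Definition unique_global_solution (R : realType) (n : nat) (O : set 'rV[R]_n)
    (F : 'rV[R]_n -> 'rV[R]_n) (x0 : 'rV[R]_n) : Prop :=
  exists x : R -> 'rV[R]_n,
    [/\ is_solution O F +oo%E x, x 0 = x0 &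
        forall (T : \bar R) (y : R -> 'rV[R]_n),
          is_solution O F T y -> y 0 = x0 ->
          forall t : R, 0 <= t -> (t%:E < T)%E -> y t = x t].

Definition locally_exp_stable (R : realType) (n : nat) (O : set 'rV[R]_n)
    (F : 'rV[R]_n -> 'rV[R]_n) : Prop :=
  F 0 = 0 /\
  exists M lambda delta : R,
    [/\ 0 < M, 0 < lambda, 0 < delta &
        forall (T : \bar R) (x : R -> 'rV[R]_n),
          is_solution O F T x -> `|x 0| < delta ->
          forall t : R, 0 <= t -> (t%:E < T)%E ->
            `|x t| <= M * expR (- (lambda * t)) * `|x 0|].

Definition exp_stabilizes (R : realType) (n m : nat)
    (X : set 'rV[R]_n) (U : set 'rV[R]_m)
    (f : 'rV[R]_n * 'rV[R]_m -> 'rV[R]_n)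
    (O : set 'rV[R]_n) (h : 'rV[R]_n -> 'rV[R]_n * 'rV[R]_m) : Prop :=
  [/\ nbhs (0 : 'rV[R]_n) O /\ O `<=` X,
      (forall x, O x -> (X `*` U) (h x)),
      {within O, continuous (comp_op h f)},
      (\forall x0 \near (0 : 'rV[R]_n),
         unique_global_solution O (comp_op h f) x0) &
      locally_exp_stable O (comp_op h f)].

Definition stationary (R : realType) (n m : nat)
    (h : 'rV[R]_n -> 'rV[R]_n * 'rV[R]_m) : Prop := h 0 = (0, 0).

(* Main.v *)
Require Import Defs.
From mathcomp Require Import all_boot all_order all_algebra.
From mathcomp Require Import all_classical all_reals all_analysis.
From mathcomp Require Import ring.
Import Order.TTheory GRing.Theory Num.Theory.
Import numFieldNormedType.Exports.
Local Open Scope classical_set_scope.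
Local Open Scope ring_scope.

(** The relation that openness provides can be inverted pointwise: every point
of a neighborhood of [f z] is the value of [f] at some admissible point, so the
axiom of choice gives a right inverse of [f] near [f z], and it may be taken to
send [f z] to [z] ([open_at_right_inverse]). Nothing makes this inverse
continuous, but a composition operator only sees the composite. Choosing as
symbol [h x] a preimage of [- x] turns the control system into [x' = - x] near
the origin, whose right-hand side is continuous whatever [h] is.

It remains to solve [x' = - x] on a ball centred at the origin, for derivatives
that are relative to the half-line [0, +oo[. The curve [expR (- t) *: x0] is a
solution, and it stays in the ball because a ball is star-shaped about its
centre ([decay_is_solution]). Conversely, any solution, even one defined on a
bounded interval only, has this form, since [x t] multiplied by [expR t] has
derivative zero ([solution_decay]). Uniqueness and the exponential estimate,
with constants [M = lambda = 1], both follow from this formula. *)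

Lemma dnbhs_shift {R : realType} (t : R) : t^' = (h + t) @[h --> 0^'].
Proof.
apply/funext => A.
change ((\forall z \near t, z != t -> A z) =
        (\forall h \near 0, h != 0 -> A (h + t))).
rewrite (near_shift 0) subr0.
by congr (nbhs _ _); apply/funext => h /=; rewrite -subr_eq0 addrK.
Qed.

(** The derivative is defined by increments [h] tending to 0, solutions of
differential equations by difference quotients at [s] tending to [t]. *)
Lemma is_derive_quotientP {R : realType} (u : R -> R) (t d : R) :
  is_derive t 1 u d <->
  (s - t)^-1 * (u s - u t) @[s --> t^'] --> d.
Proof.
rewrite dnbhs_shift.
have -> : (s - t)^-1 * (u s - u t) @[s --> (h + t) @[h --> (0 : R)^']] =
    h^-1 *: ((u \o shift t) (h *: 1) - u t) @[h --> (0 : R)^'].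
  transitivity ((h + t - t)^-1 * (u (h + t) - u t) @[h --> (0 : R)^']) => //.
  congr (fmap _ 0^'); apply/funext => h /=.
  by rewrite addrK /GRing.scale /= mulr1.
split=> [[du <-] //|qd]; split; first exact: cvgP qd.
exact: cvg_lim qd.
Qed.

(** Differentiability relative to [A] implies continuity relative to [A]; this
covers the end point of a half-line, where only a one-sided derivative exists. *)
Lemma quotient_cvg_continuous {R : realType} (A : set R) (u : R -> R)
    (t d : R) :
  (s - t)^-1 * (u s - u t) @[s --> within A t^'] --> d ->
  u s @[s --> within A (nbhs t)] --> u t.
Proof.
move=> qd.
have ut : u s @[s --> within A t^'] --> u t.
  have uE : u = fun s => u t + (s - t) * ((s - t)^-1 * (u s - u t)).
    apply/funext => s.
    have [->|st] := eqVneq s t; first by rewrite !subrr mul0r addr0.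
    by rewrite mulrA divff ?mul1r ?subr_eq0// addrC subrK.
  (* The limit [u t] is written [u t + (t - t) * d] to match [uE]. *)
  rewrite -[X in _ --> X]addr0 -[X in _ --> _ + X](mul0r d) -(subrr t) {1}uE.
  apply: cvgD; first exact: cvg_cst.
  apply: cvgM => //; apply: cvg_within_filter; apply: cvgB; last exact: cvg_cst.
  exact: (cvg_trans (@nbhs_dnbhs _ t)).
move=> B nB; have /= := ut B nB; move/nbhs_singleton: nB => But.
change (nbhs t (fun s => s != t -> A s -> B (u s)) ->
        nbhs t (fun s => A s -> B (u s))).
apply: filterS => s Bus As; have [->//|st] := eqVneq s t; exact: Bus.
Qed.

(** The product [u s * expR s] has derivative zero on ]0, b[ and is continuous up
to the end points, so the mean value theorem makes it take equal values at 0
and [b]. *)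
Lemma scalar_decay_unique {R : realType} (u : R -> R) (b : R) : 0 <= b ->
  (forall t, 0 <= t <= b ->
     (s - t)^-1 * (u s - u t) @[s --> within [set s : R | 0 <= s] t^']
       --> - u t) ->
  u b = expR (- b) * u 0.
Proof.
move=> b0 du.
pose g s := u s * expR s.
have [x x0b||c _] := @MVT_segment R g (fun=> 0) 0 b b0.
- have x0 : 0 < x by move: x0b; rewrite in_itv /= => /andP[].
  have xb : 0 <= x <= b by move: x0b; rewrite in_itv /= => /andP[/ltW-> /ltW->].
  have dux : is_derive x 1 u (- u x).
    apply/is_derive_quotientP; apply: cvg_trans (du x xb).
    apply: cvg_app => B.
    change (nbhs x (fun s => s != x -> 0 <= s -> B s) ->
            nbhs x (fun s => s != x -> B s)).
    apply: filterS2 (lt_nbhsr x0) => s /= s0 Bs /Bs; apply; exact: ltW.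
  apply: is_derive_eq.
  by rewrite /GRing.scale /=; ring.
- apply/subspace_continuousP => x; rewrite /= in_itv /= => xb.
  apply: cvgM; last by apply: cvg_within_filter; exact: continuous_expR.
  apply: cvg_trans (quotient_cvg_continuous _ _ _ _ (du x xb)).
  apply: cvg_app => B.
  change (nbhs x (fun s => 0 <= s -> B s) ->
          nbhs x (fun s => s \in `[0, b] -> B s)).
  apply: filterS => s Bs; rewrite in_itv /= => /andP[s0 _]; exact: Bs.
rewrite mul0r /g expR0 mulr1 => /eqP; rewrite subr_eq0 => /eqP <-.
by rewrite mulrCA -expRD addNr expR0 mulr1.
Qed.

(** Asking [O] to contain the segment from 0 to [x0] is what keeps the curve in
the domain, as [0 < expR (- t) <= 1] for [t >= 0]. *)
Lemma decay_is_solution {R : realType} {n : nat} (O : set 'rV[R]_n)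
    (F : 'rV[R]_n -> 'rV[R]_n) (x0 : 'rV[R]_n) :
  (forall c, 0 <= c <= 1 -> O (c *: x0)) ->
  (forall x, O x -> F x = - x) ->
  is_solution O F +oo%E (fun t => expR (- t) *: x0).
Proof.
move=> Ox0 FO t t0 _.
have Ot : O (expR (- t) *: x0).
  by apply: Ox0; rewrite expR_ge0 -expR0 ler_expR oppr_le0.
split=> //=; rewrite FO //.
have -> : (fun s => (s - t)^-1 *: (expR (- s) *: x0 - expR (- t) *: x0)) =
    fun s => ((s - t)^-1 * (expR (- s) - expR (- t))) *: x0.
  by apply/funext => s; rewrite -scalerBl scalerA.
rewrite -scaleNr; apply: cvgZl; apply: cvg_within_filter.
apply/is_derive_quotientP; apply: is_derive_eq.
by rewrite /GRing.scale /= mulrN1.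
Qed.

(** The equation [x' = - x] decouples into scalar equations for the entries. *)
Lemma solution_decay {R : realType} {n : nat} (O : set 'rV[R]_n)
    (F : 'rV[R]_n -> 'rV[R]_n) (T : \bar R) (x : R -> 'rV[R]_n) :
  (forall y, O y -> F y = - y) -> is_solution O F T x ->
  forall t, 0 <= t -> (t%:E < T)%E -> x t = expR (- t) *: x 0.
Proof.
move=> FO solx b b0 bT; apply/rowP => i; rewrite mxE.
apply: (scalar_decay_unique (fun s => x s ord0 i)) => // t /andP[t0 tb].
have tT : (t%:E < T)%E by apply: le_lt_trans bT; rewrite lee_fin.
have [Ot] := solx t t0 tT.
rewrite FO // => /cvg_comp/(_ (@coord_continuous R 1 n ord0 i (- x t))).
rewrite mxE; apply: cvg_trans; apply: near_eq_cvg.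
by near=> s; rewrite /= !mxE.
Unshelve. all: by end_near. Qed.

(** Choosing a preimage of each point of the neighborhood [f @` D] of [f z] gives
[h], except that the preimage of [f z] itself is prescribed. *)
Lemma open_at_right_inverse {S T : topologicalType} (D : set S) (f : S -> T)
    (z : S) :
  D z -> open_at D f z ->
  exists2 h : T -> S, h (f z) = z &
    \forall y \near f z, D (h y) /\ f (h y) = y.
Proof.
move=> Dz /(_ setT filterT); rewrite setTI => nfD.
have /choice[g gP] : forall y, exists x, (f @` D) y -> D x /\ f x = y.
  move=> y; have [[x Dx fx]|nfDy] := pselect ((f @` D) y); first by exists x.
  by exists z.
exists (fun y => if y == f z then z else g y); first by rewrite eqxx.
by apply: filterS nfD => y fDy; case: eqVneq => [->|_] //; exact: gP.
Qed.

Theorem theorem4p5 (R : realType) (n m : nat)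
    (X : set 'rV[R]_n) (U : set 'rV[R]_m)
    (f : 'rV[R]_n * 'rV[R]_m -> 'rV[R]_n)
    (nbhsXU : nbhs ((0, 0) : 'rV[R]_n * 'rV[R]_m) (X `*` U))
    (cont_f : {within X `*` U, continuous f})
    (f00 : f (0, 0) = 0)
    (brockett : open_at (X `*` U) f (0, 0)) :
  exists (O : set 'rV[R]_n) (h : 'rV[R]_n -> 'rV[R]_n * 'rV[R]_m),
    exp_stabilizes X U f O h /\ stationary h.
Proof.
have [g] := open_at_right_inverse _ _ _ (nbhs_singleton nbhsXU) brockett.
rewrite f00 => g0 gP; pose h (x : 'rV[R]_n) := g (- x).
have h0 : h 0 = (0, 0) by rewrite /h oppr0.
have hP : \forall x \near (0 : 'rV[R]_n), (X `*` U) (h x) /\ f (h x) = - x.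
  rewrite -[X in \forall y \near X, _]oppr0 in gP.
  exact: (@opp_continuous _ (0 : 'rV[R]_n) _ gP).
have nX : \forall x \near (0 : 'rV[R]_n), X x.
  have [[A B] /= [nA nB] AB] := nbhsXU.
  apply: filterS nA => x Ax.
  by have [] := AB (x, 0) (conj Ax (nbhs_singleton nB)).
have /nbhs_norm0P[r /= r0 rP] :
    \forall x \near (0 : 'rV[R]_n), X x /\ (X `*` U) (h x) /\ f (h x) = - x.
  exact: filterI.
pose O := [set x : 'rV[R]_n | `|x| < r].
have FO x : O x -> comp_op h f x = - x by move=> /rP[_ []].
have nO : \forall x \near (0 : 'rV[R]_n), O x by apply/nbhs_norm0P; exists r.
exists O, h; split=> //; split.
- by split=> // x /rP[].
- by move=> x /rP[_ []].
- apply/subspace_continuousP => x Ox.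
  change (comp_op h f y @[y --> within O (nbhs x)] --> comp_op h f x).
  rewrite FO //.
  have oppx : - y @[y --> within O (nbhs x)] --> - x.
    by apply: cvg_within_filter; exact: opp_continuous.
  apply: cvg_trans oppx; apply: near_eq_cvg; rewrite near_withinE.
  by near=> y => /FO ->.
- apply: filterS nO => x0 Ox0; exists (fun t => expR (- t) *: x0); split.
  + apply: decay_is_solution => // c /andP[c0 c1].
    by rewrite /O /= normrZ ger0_norm // (le_lt_trans _ Ox0) // ler_piMl.
  + by rewrite oppr0 expR0 scale1r.
  + by move=> T y soly <- t t0 tT; exact: solution_decay soly t t0 tT.
- split; first by rewrite FO ?oppr0 // /O /= normr0.
  exists 1, 1, 1; split=> // T x solx _ t t0 tT.
  rewrite (solution_decay _ _ _ _ FO solx t t0 tT).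
  by rewrite normrZ ger0_norm ?expR_ge0 // !mul1r.
Unshelve. all: by end_near. Qed.
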